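(* Let $\nu>0$, let $\mathbf{x}_0\in\mathbb{R}^n$ be a fixed vector, and let $\Theta=\{\mathbf{x}_1,\dots,\mathbf{x}_{n+1}\}\subset\mathbb{R}^n$ be a fixed set of $n+1$ affinely independent vectors, ordered such that $\ell_1(\mathbf{x}_0)\ge\ell_2(\mathbf{x}_0)\ge\cdots\ge\ell_{n+1}(\mathbf{x}_0)$. Consider the matrix $$M=\mathrm{diag}(\ell_+)\,Y_+P_-(Y_-P_-)^{-1}\in\mathbb{R}^{|\mathcal{I}_+|\times(|\mathcal{I}_-|-1)} .$$ Let $\mu_{ij}=[M]_{i,\,j-n-2+|\mathcal{I}_-|}$ for all $i\in\mathcal{I}_+$ and $j\in\mathcal{I}_-\setminus\{0\}$, and $\mu_{i0}=\ell_i(\mathbf{x}_0)-\sum_{j\in\mathcal{I}_-\setminus\{0\}}\mu_{ij}$ for all $i\in\mathcal{I}_+$. If $\mu_{ij}\ge0$ for all $(i,j)\in\mathcal{I}_+\times\mathcal{I}_-$, then $$\underline z(\Theta,\mathbf{x}_0)=z(\Theta,\mathbf{x}_0),$$ where $\underline z(\Theta,\mathbf{x}_0)=\frac{\nu}{2}\sum_{i=1}^n|\lambda_i|$ and $z(\Theta,\mathbf{x}_0)$ is the sharp error bound, i.e. the maximum of $|\hat f(\mathbf{x}_0)-f(\mathbf{x}_0)|$ over all $f\in C^{1,1}_\nu(\mathbb{R}^n)$.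
   Context: $C^{1,1}_\nu(\mathbb{R}^n)$ is the class of continuously differentiable functions $f:\mathbb{R}^n\to\mathbb{R}$ with $\|Df(\mathbf{u})-Df(\mathbf{v})\|\le\nu\|\mathbf{u}-\mathbf{v}\|$ for all $\mathbf{u},\mathbf{v}$ (Euclidean norms). For each $f$, $\hat f$ is the unique affine function with $\hat f(\mathbf{x}_i)=f(\mathbf{x}_i)$, $i=1,\dots,n+1$. For $i=1,\dots,n+1$, $\ell_i$ is the Lagrange polynomial of $\Theta$: the unique affine function with $\ell_i(\mathbf{x}_j)=1$ if $j=i$ and $0$ if $j\neq i$ ($j=1,\dots,n+1$); additionally $\ell_0\equiv-1$. Index sets: $\mathcal{I}_+=\{i\in\{0,\dots,n+1\}:\ell_i(\mathbf{x}_0)>0\}=\{1,\dots,|\mathcal{I}_+|\}$ and $\mathcal{I}_-=\{i\in\{0,\dots,n+1\}:\ell_i(\mathbf{x}_0)<0\}=\{0,\,n-|\mathcal{I}_-|+3,\dots,n+1\}$. Matrices: $\mathrm{diag}(\ell_+)$ is the diagonal matrix with entries $\ell_i(\mathbf{x}_0)$, $i\in\mathcal{I}_+$, in order. $Y\in\mathbb{R}^{(n+1)\times n}$ has $i$th row $(\mathbf{x}_i-\mathbf{x}_0)^T$; $Y_+$ consists of its first $|\mathcal{I}_+|$ rows and $Y_-$ of its last $|\mathcal{I}_-|-1$ rows. $G=\sum_{i=0}^{n+1}\ell_i(\mathbf{x}_0)\mathbf{x}_i\mathbf{x}_i^T$ has eigenvalues $\lambda_1,\dots,\lambda_n$ and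 eigendecomposition $G=P\Lambda P^T$ with $P$ orthogonal. $G$ has exactly $|\mathcal{I}_-|-1$ negative eigenvalues, and $P_-\in\mathbb{R}^{n\times(|\mathcal{I}_-|-1)}$ is the submatrix of $P$ whose columns are the corresponding orthonormal eigenvectors. The square matrix $Y_-P_-$ is invertible. When $\mathcal{I}_-=\{0\}$, $M$ has no columns and $\mu_{i0}=\ell_i(\mathbf{x}_0)$ for all $i\in\mathcal{I}_+$. *)

(* Defs.v *)
From HB Require Import structures.
From mathcomp Require Import all_boot all_order all_algebra.
From mathcomp Require Import all_classical all_reals all_analysis.
Import Order.TTheory GRing.Theory Num.Theory.
Import numFieldNormedType.Exports.

Set Implicit Arguments.
Unset Strict Implicit.
Unset Printing Implicit Defensive.

Local Open Scope classical_set_scope.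
Local Open Scope ring_scope.

(* The library norm on ['cV[R]_n] is the sup norm, hence this definition; the
   two norms induce the same topology and the same notion of
   differentiability. *)
Definition enorm (R : realType) (n : nat) (u : 'cV[R]_n) : R :=
  Num.sqrt (\sum_(i < n) u i 0 ^+ 2).

Definition gradient (R : realType) (n : nat) (f : 'cV[R]_n -> R)
    (u : 'cV[R]_n) : 'cV[R]_n :=
  \col_(i < n) 'D_(delta_mx i 0) f u.

Definition C11 (R : realType) (n : nat) (nu : R) (f : 'cV[R]_n -> R) : Prop :=
  [/\ forall u, differentiable f u,
      continuous (gradient f)
    & forall u v,
        enorm (gradient f u - gradient f v) <= nu * enorm (u - v)].

Definition affine_fun (R : realType) (n : nat) (g : 'cV[R]_n -> R) : Prop :=
  exists (a : 'cV[R]_n) (c : R), forall u, g u = \sum_(k < n) a k 0 * u k 0 + c.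

(* Throughout, [x : 'I_n.+2 -> 'cV[R]_n] packs together x_0 = [x ord0] and the
   sample set Theta = {x_1, ..., x_(n+1)}, the points [x i] with [i != ord0]. *)

Definition affinely_independent (R : realType) (n m : nat)
    (y : 'I_m -> 'cV[R]_n) : Prop :=
  forall c : 'I_m -> R,
    \sum_(k < m) c k = 0 -> \sum_(k < m) c k *: y k = 0 -> forall k, c k = 0.

Definition interpolant (R : realType) (n : nat) (x : 'I_n.+2 -> 'cV[R]_n)
    (f fhat : 'cV[R]_n -> R) : Prop :=
  affine_fun fhat /\ forall i, i != ord0 -> fhat (x i) = f (x i).

Definition lagrange_basis (R : realType) (n : nat) (x : 'I_n.+2 -> 'cV[R]_n)
    (ell : 'I_n.+2 -> 'cV[R]_n -> R) : Prop :=
  (forall u, ell ord0 u = -1) /\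
  (forall i, i != ord0 ->
     affine_fun (ell i) /\
     forall j, j != ord0 -> ell i (x j) = (j == i)%:R).

Definition interpolation_errors (R : realType) (n : nat) (nu : R)
    (x : 'I_n.+2 -> 'cV[R]_n) : set R :=
  [set e | exists f fhat : 'cV[R]_n -> R,
     [/\ C11 nu f, interpolant x f fhat & e = `|fhat (x ord0) - f (x ord0)|]].

Definition sharp_error_bound (R : realType) (n : nat) (nu : R)
    (x : 'I_n.+2 -> 'cV[R]_n) (z : R) : Prop :=
  interpolation_errors nu x z /\ ubound (interpolation_errors nu x) z.

Section ErrorMatrices.
Variables (R : realType) (n : nat).
Variables (x : 'I_n.+2 -> 'cV[R]_n) (ell : 'I_n.+2 -> 'cV[R]_n -> R).

Definition Iplus : {set 'I_n.+2} := [set i | 0 < ell i (x ord0)]%SET.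
Definition Iminus : {set 'I_n.+2} := [set i | ell i (x ord0) < 0]%SET.

(* Matrix rows are numbered from 0, so row [k] of [Ymx] belongs to x_(k+1).
   In [Yplus], [Yminus] and [diag_ell_plus] the arguments of [inord] are in
   range, since #|Iplus| + (#|Iminus| - 1) <= n + 1. *)
Definition Ymx : 'M[R]_(n.+1, n) :=
  \matrix_(k < n.+1) (x (lift ord0 k) - x ord0)^T.

Definition Yplus : 'M[R]_(#|Iplus|, n) :=
  rowsub (fun k : 'I_#|Iplus| => inord k) Ymx.

Definition Yminus : 'M[R]_(#|Iminus|.-1, n) :=
  rowsub (fun k : 'I_#|Iminus|.-1 => inord (n.+1 - #|Iminus|.-1 + k)) Ymx.

Definition diag_ell_plus : 'M[R]_#|Iplus| :=
  diag_mx (\row_(k < #|Iplus|) ell (inord k.+1) (x ord0)).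

Definition Gmx : 'M[R]_n :=
  \sum_(i < n.+2) ell i (x ord0) *: (x i *m (x i)^T).

Definition eigendecomposition (G P : 'M[R]_n) (lambda : 'rV[R]_n) : Prop :=
  P^T *m P = 1%:M /\ G = P *m diag_mx lambda *m P^T.

Definition negative_eigs (lambda : 'rV[R]_n) : {set 'I_n} :=
  [set j | lambda 0 j < 0]%SET.

(* The columns of P with negative eigenvalue, which number #|Iminus| - 1 when
   (P, lambda) diagonalizes G. [conform_mx] only transports the selected
   submatrix along this equality of dimensions; its default is never used. *)
Definition Pminus (P : 'M[R]_n) (lambda : 'rV[R]_n) :
    'M[R]_(n, #|Iminus|.-1) :=
  conform_mx 0
    (colsub (fun k : 'I_#|negative_eigs lambda| => enum_val k) P).

Definition Mmx (P : 'M[R]_n) (lambda : 'rV[R]_n) :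
    'M[R]_(#|Iplus|, #|Iminus|.-1) :=
  diag_ell_plus *m Yplus *m Pminus P lambda
    *m invmx (Yminus *m Pminus P lambda).

End ErrorMatrices.

Definition z_lower (R : realType) (n : nat) (nu : R) (lambda : 'rV[R]_n) : R :=
  nu / 2 * \sum_(j < n) `|lambda 0 j|.

(* Main.v *)
Require Import Defs.
From HB Require Import structures.
From mathcomp Require Import all_boot all_order all_algebra.
From mathcomp Require Import all_classical all_reals all_analysis.
From mathcomp Require Import ring lra.
Import Order.TTheory GRing.Theory Num.Theory.
Import numFieldNormedType.Exports.

Local Open Scope ring_scope.

(** Write [l i] for [ell i (x ord0)], [I] and [J] for the sets of indices of
    positive and of negative weight ([ord0 \in J]), [G] for [Gmx x ell].

    The weights [l i] annihilate affine functions, so the interpolation error at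
    [x ord0] is [\sum_i l i * f (x i)] ([interpolation_error]).  Let [Q] be the
    orthogonal projector onto the negative eigenspace of [G].  The involution
    [1 - 2 Q] is the sign of [G] (taken as 1 on the kernel), so
    [\tr ((1 - 2 Q) G)] is the sum of the [`|lambda j|] ([trace_sign]), and the quadratic function
    [u |-> nu / 2 * u^T (1 - 2 Q) u], which lies in the class because [1 - 2 Q]
    is an isometry, has exactly the error [z_lower] ([z_lower_attained]).

    For the upper bound, [mu] is a transport plan: it is nonnegative, its row
    sums are the weights on [I] and its column sums the opposite weights on [J].
    Hence the error is the sum of the [mu i j * (f (x i) - f (x j))].  Each
    difference is bounded by passing through the point [w] such that
    [w - x j = (1 - Q) (x i - x j)] and [w - x i = - Q (x i - x j)]: the
    quadratic upper model of [f] at [x j] and the lower model at [x i] give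
    [f (x i) - f (x j) <= Df(x i).Q d + Df(x j).(1 - Q) d + nu / 2 * |d| ^ 2]
    where [d = x i - x j].  After weighting by [mu] and summing, the gradient
    terms vanish, because [mu] satisfies two balance equations:
    [Q (\sum_j mu i j *: (x i - x j)) = 0] for [i] in [I], and
    [(1 - Q) (\sum_i mu i j *: (x i - x j)) = 0] for [j] in [J]
    ([transport_le]).  What is left does not depend on [f], and the same
    cancellation identifies it with the error of the extremal quadratic
    function ([transport_cost]).

    The row balance equations are the definition of [Mmx].  The column ones, and
    the column sums, follow from them: when multiplied by the invertible matrix
    [Yminus *m Pminus] they become consequences of [G Q = Q G] and of
    [\sum_i l i *: (x i - x ord0) = 0] (section [Plan]).  That matrix is square
    and invertible by a law of inertia for [G] ([Yminus_colsub_inj],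
    [card_neg_ge]). *)

(** * The Euclidean inner product *)

Definition dot {R : realType} {n : nat} (u v : 'cV[R]_n) : R :=
  \sum_(i < n) u i 0 * v i 0.

Lemma dotC {R : realType} {n : nat} (u v : 'cV[R]_n) : dot u v = dot v u.
Proof. by apply: eq_bigr => i _; rewrite mulrC. Qed.

Lemma dot_linear {R : realType} {n : nat} (u : 'cV[R]_n) :
  linear_for *%R (dot u).
Proof.
move=> a v w; rewrite /dot mulr_sumr -big_split /=.
by apply: eq_bigr => i _; rewrite !mxE; ring.
Qed.

HB.instance Definition _ {R : realType} {n : nat} (u : 'cV[R]_n) :=
  GRing.isLinear.Build R 'cV[R]_n R *%R (dot u) (dot_linear u).

Section DotTheory.
Context {R : realType} {n : nat}.
Implicit Types (u v w : 'cV[R]_n) (A : 'M[R]_n).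

Lemma dotDr u v w : dot u (v + w) = dot u v + dot u w.
Proof. exact: linearD. Qed.
Lemma dotNr u v : dot u (- v) = - dot u v.
Proof. exact: linearN. Qed.
Lemma dotBr u v w : dot u (v - w) = dot u v - dot u w.
Proof. exact: linearB. Qed.
Lemma dotZr a u v : dot u (a *: v) = a * dot u v.
Proof. exact: linearZ. Qed.
Lemma dot0r u : dot u 0 = 0.
Proof. exact: linear0. Qed.
Lemma dot_sumr u I (r : seq I) (P : pred I) (F : I -> 'cV[R]_n) :
  dot u (\sum_(i <- r | P i) F i) = \sum_(i <- r | P i) dot u (F i).
Proof. exact: linear_sum. Qed.
Lemma dotNl u v : dot (- v) u = - dot v u.
Proof. by rewrite dotC dotNr (dotC u). Qed.
Lemma dotBl u v w : dot (v - w) u = dot v u - dot w u.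
Proof. by rewrite dotC dotBr !(dotC u). Qed.
Lemma dotZl a u v : dot (a *: v) u = a * dot v u.
Proof. by rewrite dotC dotZr (dotC u). Qed.
Lemma dot_suml u I (r : seq I) (P : pred I) (F : I -> 'cV[R]_n) :
  dot (\sum_(i <- r | P i) F i) u = \sum_(i <- r | P i) dot (F i) u.
Proof. by rewrite dotC dot_sumr; apply: eq_bigr => i _; rewrite dotC. Qed.

Lemma dot_mulmxl (m : nat) (B : 'M[R]_(n, m)) (u : 'cV[R]_m) v :
  dot (B *m u) v = dot u (B^T *m v).
Proof.
rewrite /dot; under eq_bigr => i _ do rewrite mxE mulr_suml.
rewrite exchange_big /=; apply: eq_bigr => j _; rewrite mxE mulr_sumr.
by apply: eq_bigr => i _; rewrite mxE; ring.
Qed.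

Lemma dot_ge0 u : 0 <= dot u u.
Proof. by apply: sumr_ge0 => i _; rewrite -expr2 sqr_ge0. Qed.

Lemma enorm_sqr u : enorm u ^+ 2 = dot u u.
Proof.
have -> : enorm u = Num.sqrt (dot u u) by [].
by rewrite sqr_sqrtr ?dot_ge0.
Qed.

Lemma enorm_ge0 u : 0 <= enorm u.
Proof. exact: sqrtr_ge0. Qed.

(** Expanding the square norm of [u - c *: v] gives this form of the
    Cauchy-Schwarz inequality. *)
Lemma dot_le_enorm (c : R) u v : 0 < c ->
  enorm u <= c * enorm v -> dot u v <= c * dot v v.
Proof.
move=> c0 uv.
have uu : dot u u <= c ^+ 2 * dot v v.
  rewrite -!enorm_sqr -exprMn ler_sqr ?nnegrE ?enorm_ge0//.
  by rewrite mulr_ge0 ?enorm_ge0 ?ltW.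
have := dot_ge0 (u - c *: v).
rewrite !(dotBl, dotBr, dotZl, dotZr) (dotC v u) => h.
rewrite -(ler_pM2l c0); nra.
Qed.

End DotTheory.

(** * Functions with Lipschitz gradient *)

Section Smooth.
Context {R : realType} {n : nat}.
Implicit Types (f : 'cV[R]_n -> R) (u v d : 'cV[R]_n).

Lemma cV_sum_delta u : u = \sum_(i < n) u i 0 *: delta_mx i 0.
Proof.
rewrite {1}(matrix_sum_delta u); apply: eq_bigr => i _.
by rewrite big_ord1.
Qed.

Lemma derive_gradient f u d : differentiable f u ->
  'D_d f u = dot (gradient f u) d.
Proof.
move=> df; rewrite deriveE// {1}(cV_sum_delta d) linear_sum /dot.
apply: eq_bigr => i _; rewrite linearZ /= /gradient mxE deriveE//.
by rewrite mulrC.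
Qed.

Lemma is_derive_line f v d (t : R) : differentiable f (v + t *: d) ->
  is_derive t (1 : R) (fun s : R => f (v + s *: d))
    (dot (gradient f (v + t *: d)) d).
Proof.
move=> df.
have dl : is_diff t (fun s : R => v + s *: d) (fun s : R => s *: d).
  by apply: is_diff_eq; rewrite add0r.
have dc : is_diff t (f \o (fun s : R => v + s *: d))
     ('d f (v + t *: d) \o (fun s : R => s *: d)).
  have df' : is_diff (v + t *: d) f ('d f (v + t *: d)) by split.
  exact: is_diff_comp.
split.
  by apply: diff_derivable; case: dc.
rewrite deriveE; last by case: dc.
rewrite [X in X _ = _](@diff_val _ _ _ _ _ _ _ dc) /= scale1r -derive_gradient//.
by rewrite deriveE.
Qed.

(** Along the segment from [v] to [w], the derivative of
    [f] minus its quadratic upper model at [v] is nonpositive, because the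
    gradient has moved by at most [nu * t * |w - v|] at time [t]. *)
Lemma descent_upper (nu : R) f v w : 0 < nu -> C11 nu f ->
  f w <= f v + dot (gradient f v) (w - v) + nu / 2 * dot (w - v) (w - v).
Proof.
move=> nu0 [df _ lip]; set d := w - v; set g := gradient f v.
pose phi (t : R) := f (v + t *: d) - (t * dot g d + (nu / 2 * dot d d) * t ^+ 2).
have dphi (t : R) : is_derive t (1:R) phi
    (dot (gradient f (v + t *: d)) d - (dot g d + nu * t * dot d d)).
  have h1 := is_derive_line f v d t (df _).
  rewrite /phi; apply: is_derive_eq.
  by rewrite /GRing.scale /=; field.
have le10 : phi 1 <= phi 0.
  apply: (@ler0_derive1_nincr _ phi 0 1) => //.
  - move=> t; rewrite in_itv/= => /andP[t0 _].
    rewrite derive1E; have [_ ->] := dphi t.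
    rewrite opprD addrA subr_le0 -dotBl; apply: dot_le_enorm.
      by rewrite mulr_gt0.
    apply: le_trans (lip _ _) _.
    rewrite addrAC subrr add0r.
    suff -> : enorm (t *: d) = t * enorm d by rewrite mulrA.
    rewrite /enorm; under eq_bigr => i _ do rewrite mxE exprMn.
    by rewrite -mulr_sumr sqrtrM ?sqr_ge0// sqrtr_sqr gtr0_norm.
  - apply: derivable_within_continuous => t _.
    by case: (dphi t).
have vd : v + d = w by rewrite /d addrC subrK.
move: le10; rewrite /phi scale1r scale0r addr0 vd.
move: (f w) (f v) (dot g d) (dot d d) => fw fv gd dd; lra.
Qed.

Lemma C11N (nu : R) f : C11 nu f ->
  C11 nu (fun u => - f u) /\ gradient (fun u => - f u) = (fun u => - gradient f u).
Proof.
move=> [df cf lf].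
have gN : gradient (fun u => - f u) = (fun u => - gradient f u).
  apply/funext => u; apply/matrixP => i j; rewrite !mxE.
  by rewrite deriveN //; exact: diff_derivable.
split; last exact: gN.
split.
- by move=> u; apply: differentiableN.
- by rewrite gN => u; apply: continuousN; exact: cf.
- move=> u v; rewrite gN -opprD; apply: le_trans (lf u v).
  by rewrite /enorm; under eq_bigr => i _ do rewrite mxE sqrrN.
Qed.

Lemma descent_lower (nu : R) f v w : 0 < nu -> C11 nu f ->
  f v + dot (gradient f v) (w - v) - nu / 2 * dot (w - v) (w - v) <= f w.
Proof.
move=> nu0 /C11N[cf gN]; have := descent_upper nu _ v w nu0 cf.
rewrite gN dotNl.
move: (f w) (f v) (dot _ _) (dot _ _) => fw fv gd dd; lra.
Qed.


Lemma differentiable_dot (a : 'cV[R]_n) u : differentiable (dot a) u.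
Proof.
have -> : dot a = \sum_(i < n) (fun w : 'cV[R]_n => a i 0 *: (w i 0 : R)).
  by apply/funext => w; rewrite fct_sumE.
apply: differentiable_sum => i; apply: differentiableZ.
exact: differentiable_coord.
Qed.

Lemma is_derive_dot (a : 'cV[R]_n) u d : is_derive u d (dot a) (dot a d).
Proof.
split; first exact/diff_derivable/differentiable_dot.
rewrite deriveE; last exact: differentiable_dot.
by rewrite diff_lin// => v; apply/differentiable_continuous/differentiable_dot.
Qed.

Lemma dot_delta (i : 'I_n) u : dot (delta_mx i 0) u = u i 0.
Proof.
rewrite /dot (bigD1 i)//= mxE !eqxx mul1r big1 ?addr0// => j ji.
by rewrite mxE (negbTE ji) mul0r.
Qed.

Section Quadratic.
Variables (c : R) (A : 'M[R]_n).
Hypothesis A_sym : A^T = A.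

Lemma quadratic_sum : (fun u => c * dot u (A *m u)) =
  c *: \sum_(i < n) (dot (delta_mx i 0) * dot (A *m delta_mx i 0)).
Proof.
apply/funext => u; rewrite [RHS]/(c * _) fct_sumE; congr (_ * _).
apply: eq_bigr => i _.
by rewrite [RHS]/(dot _ _ * dot _ _) dot_mulmxl A_sym !dot_delta.
Qed.

Lemma differentiable_quadratic u :
  differentiable (fun u => c * dot u (A *m u)) u.
Proof.
rewrite quadratic_sum; apply: differentiableZ; apply: differentiable_sum => i.
by apply: differentiableM; exact: differentiable_dot.
Qed.

Lemma gradient_quadratic u :
  gradient (fun u => c * dot u (A *m u)) u = (2 * c) *: (A *m u).
Proof.
apply/matrixP => k j; rewrite (ord1 j) !mxE.
have : is_derive u (delta_mx k 0) (fun u => c * dot u (A *m u))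
  (c *: \sum_(i < n) (dot (delta_mx i 0) u *: dot (A *m delta_mx i 0) (delta_mx k 0)
     + dot (A *m delta_mx i 0) u *: dot (delta_mx i 0) (delta_mx k 0))).
  rewrite quadratic_sum; apply: is_deriveZ; apply: is_derive_sum => i.
  by apply: is_deriveM; exact: is_derive_dot.
case=> _ ->; rewrite big_split /=.
have e1 : \sum_(i < n) dot (delta_mx i 0) u *: dot (A *m delta_mx i 0) (delta_mx k 0)
    = dot u (A *m delta_mx k 0).
  by apply: eq_bigr => i _; rewrite dot_delta dot_mulmxl A_sym dot_delta.
have e2 : \sum_(i < n) dot (A *m delta_mx i 0) u *: dot (delta_mx i 0) (delta_mx k 0)
    = dot (A *m u) (delta_mx k 0).
  by apply: eq_bigr => i _; rewrite dot_mulmxl A_sym !dot_delta.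
rewrite e1 e2 dotC dot_mulmxl A_sym (dotC (A *m u)) !dot_delta mxE /GRing.scale /=.
ring.
Qed.

Lemma C11_quadratic (nu : R) : 0 <= nu -> c = nu / 2 -> A *m A = 1%:M ->
  C11 nu (fun u => c * dot u (A *m u)).
Proof.
move=> nu0 ce AA; have gE : gradient (fun u => c * dot u (A *m u)) =
    (fun u => nu *: (A *m u)).
  apply/funext => u; by rewrite gradient_quadratic ce; congr (_ *: _); field.
split; first exact: differentiable_quadratic.
- rewrite gE => u.
  have -> : (fun u : 'cV[R]_n => nu *: (A *m u)) =
      \sum_(i < n) (fun u : 'cV[R]_n =>
         dot (nu *: (A *m delta_mx i 0)) u *: (delta_mx i 0 : 'cV[R]_n)).
    apply/funext => v; rewrite fct_sumE [LHS]cV_sum_delta.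
    apply: eq_bigr => i _; congr (_ *: _).
    by rewrite mxE dotZl dot_mulmxl A_sym dot_delta.
  apply: differentiable_continuous; apply: differentiable_sum => i.
  by apply: differentiableZl; exact: differentiable_dot.
- move=> u v; rewrite gE -scalerBr -mulmxBr.
  have sq (w : 'cV[R]_n) : enorm w = Num.sqrt (dot w w) by [].
  rewrite !sq dotZl dotZr dot_mulmxl A_sym mulmxA AA mul1mx mulrA -expr2.
  by rewrite sqrtrM ?sqr_ge0// sqrtr_sqr ger0_norm.
Qed.

End Quadratic.

End Smooth.

(** * Lagrange polynomials and the matrix G *)

Section Lagrange.
Context {R : realType} {n : nat}.
Variables (x : 'I_n.+2 -> 'cV[R]_n) (ell : 'I_n.+2 -> 'cV[R]_n -> R).
Hypothesis ellP : lagrange_basis x ell.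

Local Notation l i := (ell i (x ord0)).

Lemma lagrange_coef : exists (a : 'I_n.+1 -> 'cV[R]_n) (c : 'I_n.+1 -> R),
  forall k u, ell (lift ord0 k) u = dot (a k) u + c k.
Proof.
have h (k : 'I_n.+1) : exists ac : 'cV[R]_n * R,
    forall u, ell (lift ord0 k) u = dot ac.1 u + ac.2.
  by have [[a [c h]] _] := (ellP.2 (lift ord0 k) isT); exists (a, c).
have [ac acP] := choice h.
by exists (fun k => (ac k).1), (fun k => (ac k).2).
Qed.

(** In homogeneous coordinates, the matrix [L] of the coefficients of the
    Lagrange polynomials is a left inverse of the square matrix [E] of the
    points, hence also a right inverse, and [E *m (L *m e u) = e u] is the
    claim. *)
Lemma lagrange_sum u :
  \sum_(k < n.+1) ell (lift ord0 k) u = 1 /\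
  \sum_(k < n.+1) ell (lift ord0 k) u *: x (lift ord0 k) = u.
Proof.
have [a [c acP]] := lagrange_coef.
pose e (v : 'cV[R]_n) : 'cV[R]_n.+1 :=
  \col_i oapp (fun j : 'I_n => v j 0) 1 (unlift ord0 i).
pose E : 'M[R]_n.+1 := \matrix_(i, k) e (x (lift ord0 k)) i 0.
pose L : 'M[R]_n.+1 :=
  \matrix_(k, i) oapp (fun j : 'I_n => a k j 0) (c k) (unlift ord0 i).
have Le v k : (L *m e v) k 0 = ell (lift ord0 k) v.
  rewrite mxE big_ord_recl !mxE unlift_none /= mulr1 acP addrC; congr (_ + _).
  by apply: eq_bigr => j _; rewrite !mxE liftK.
have LE : L *m E = 1%:M.
  apply/matrixP => k k'; rewrite [RHS]mxE.
  have -> : (L *m E) k k' = (L *m e (x (lift ord0 k'))) k 0.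
    by rewrite !mxE; apply: eq_bigr => i _; rewrite [E _ _]mxE.
  rewrite Le (ellP.2 (lift ord0 k) isT).2// (inj_eq (@lift_inj _ _)).
  by rewrite eq_sym.
have EL : E *m (L *m e u) = e u by rewrite mulmxA (mulmx1C LE) mul1mx.
split.
  have /matrixP/(_ ord0 0) := EL.
  rewrite [LHS]mxE [RHS]mxE unlift_none /= => <-.
  by apply: eq_bigr => k _; rewrite Le !mxE unlift_none mul1r.
apply/matrixP => j z; rewrite (ord1 z) summxE.
have /matrixP/(_ (lift ord0 j) 0) := EL.
rewrite [LHS]mxE [RHS]mxE liftK /= => <-.
by apply: eq_bigr => k _; rewrite Le !mxE liftK mulrC.
Qed.

Lemma sum_ell : \sum_i l i = 0.
Proof. by rewrite big_ord_recl ellP.1 (lagrange_sum _).1 addNr. Qed.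

Lemma sum_ell_x : \sum_i l i *: x i = 0.
Proof. by rewrite big_ord_recl ellP.1 (lagrange_sum _).2 scaleN1r addNr. Qed.

Lemma sum_ell_affine g : affine_fun g -> \sum_i l i * g (x i) = 0.
Proof.
move=> [a [c gE]].
rewrite (eq_bigr (fun i => dot a (l i *: x i) + l i * c)); last first.
  by move=> i _; rewrite gE -/(dot _ _) dotZr mulrDr.
by rewrite big_split /= -dot_sumr -mulr_suml sum_ell_x sum_ell dot0r mul0r addr0.
Qed.

Lemma interpolation_error f fhat : interpolant x f fhat ->
  fhat (x ord0) - f (x ord0) = \sum_i l i * f (x i).
Proof.
move=> [/sum_ell_affine h fi]; move: h; rewrite !(big_ord_recl n.+1) ellP.1 !mulN1r.
have -> : \sum_(k < n.+1) l (lift ord0 k) * fhat (x (lift ord0 k)) =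
          \sum_(k < n.+1) l (lift ord0 k) * f (x (lift ord0 k)).
  by apply: eq_bigr => k _; rewrite fi.
by move/eqP; rewrite addrC subr_eq0 => /eqP ->; rewrite addrC.
Qed.

Lemma interpolant_exists f : exists fhat, interpolant x f fhat.
Proof.
have [a [c acP]] := lagrange_coef.
exists (fun u => \sum_(k < n.+1) f (x (lift ord0 k)) * ell (lift ord0 k) u).
split.
  exists (\sum_(k < n.+1) f (x (lift ord0 k)) *: a k).
  exists (\sum_(k < n.+1) f (x (lift ord0 k)) * c k) => u.
  rewrite -/(dot _ _) dot_suml -big_split /=; apply: eq_bigr => k _.
  by rewrite dotZl acP mulrDr.
move=> i i0; case: (unliftP ord0 i) i0 => [j ->|->]; last by rewrite eqxx.
move=> _; rewrite (bigD1 j)//= big1 ?addr0 => [|k kj].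
  by rewrite (ellP.2 (lift ord0 j) isT).2// eqxx mulr1.
rewrite (ellP.2 (lift ord0 k) isT).2// (inj_eq (@lift_inj _ _)).
by rewrite eq_sym (negbTE kj) mulr0.
Qed.

(** Replacing the points by a common translate, and the values of a linear form
    by those of an affine one, does not change [G], because the
    weights [l i] annihilate affine functions. *)
Lemma Gmx_mulE (v z : 'cV[R]_n) (c : R) :
  Gmx x ell *m v = \sum_i (l i * (dot (x i) v + c)) *: (x i + z).
Proof.
have GE : Gmx x ell *m v = \sum_i (l i * dot (x i) v) *: x i.
  rewrite /Gmx mulmx_suml; apply: eq_bigr => i _.
  rewrite -scalemxAl -mulmxA -scalerA; congr (_ *: _).
  apply/matrixP => a b; rewrite (ord1 b) !mxE big_ord1 mulrC; congr (_ * _).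
  by rewrite mxE; apply: eq_bigr => k _; rewrite mxE.
rewrite (eq_bigr (fun i => (l i * dot (x i) v) *: x i +
   (c *: (l i *: x i) + (l i * (dot (x i) v + c)) *: z))); last first.
  move=> i _; rewrite scalerDr [in RHS]addrA; congr (_ + _).
  by rewrite scalerA -scalerDl mulrDr (mulrC c).
rewrite !big_split /= -GE -scaler_sumr sum_ell_x scaler0 add0r -scaler_suml.
have aff : affine_fun (fun u => dot u v + c).
  by exists v, c => u; rewrite dotC.
by rewrite (sum_ell_affine _ aff) scale0r addr0.
Qed.

(** The freedom in [c] is what makes the signs readable: [c] is chosen below so
    that the squares vanish at the points of one sign. *)
Lemma Gmx_form (w : 'cV[R]_n) (c : R) :
  dot w (Gmx x ell *m w) = \sum_i l i * (dot (x i) w + c) ^+ 2.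
Proof.
have aff : affine_fun (fun u => c * (dot u w + c)).
  exists (c *: w), (c * c) => u.
  by rewrite -/(dot _ _) dotZl (dotC w) mulrDr.
rewrite -[RHS]subr0 -[X in _ = _ - X](sum_ell_affine _ aff) -sumrB.
rewrite (Gmx_mulE w 0 c) dot_sumr.
by apply: eq_bigr => i _; rewrite addr0 dotZr (dotC w); ring.
Qed.

Lemma Gmx_trace (A : 'M[R]_n) :
  \sum_i l i * dot (x i) (A *m x i) = \tr (A *m Gmx x ell).
Proof.
rewrite /Gmx mulmx_sumr raddf_sum /=; apply: eq_bigr => i _.
rewrite -scalemxAr mxtraceZ mulmxA mxtrace_mulC; congr (_ * _).
rewrite /mxtrace big_ord1 !mxE; apply: eq_bigr => k _; rewrite !mxE //.
Qed.

End Lagrange.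

(** * The upper bound from a transport plan *)

Section Transport.
Context {R : realType} {n : nat} {T : finType}.
Variables (I J : {set T}) (x : T -> 'cV[R]_n) (mu : T -> T -> R).
Variable Q : 'M[R]_n.
Hypothesis Q_sym : Q^T = Q.
Hypothesis Q_idem : Q *m Q = Q.
Hypothesis row_balance : forall i, i \in I ->
  Q *m (\sum_(j in J) mu i j *: (x i - x j)) = 0.
Hypothesis col_balance : forall j, j \in J ->
  Q *m (\sum_(i in I) mu i j *: (x i - x j)) =
  \sum_(i in I) mu i j *: (x i - x j).

(** Terms depending on [i] and on the [Q]-component of the displacement cancel
    by the row balance, terms depending on [j] and on the complementary component
    by the column balance. *)
Lemma balance_cancel (p q : T -> 'cV[R]_n) :
  \sum_(i in I) \sum_(j in J) mu i j *
    (dot (p i) (Q *m (x i - x j)) +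
     dot (q j) ((x i - x j) - Q *m (x i - x j))) = 0.
Proof.
under eq_bigr => i _ do under eq_bigr => j _ do rewrite mulrDr.
under eq_bigr => i _ do rewrite big_split /=.
rewrite big_split /= [X in X + _]big1 ?add0r => [|i iI].
  rewrite exchange_big big1 //= => j jJ.
  rewrite -[RHS](dot0r (q j)) -(subrr (\sum_(i in I) mu i j *: (x i - x j))).
  rewrite -[X in _ - X]col_balance // mulmx_sumr -sumrB dot_sumr.
  by apply: eq_bigr => i _; rewrite -scalemxAr -scalerBr dotZr.
rewrite -[RHS](dot0r (p i)) -(row_balance i iI) mulmx_sumr dot_sumr.
by apply: eq_bigr => j _; rewrite -scalemxAr dotZr.
Qed.

Lemma proj_pythagoras (d : 'cV[R]_n) :
  dot d d = dot (d - Q *m d) (d - Q *m d) + dot (Q *m d) (Q *m d).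
Proof.
have QQ : dot (Q *m d) (Q *m d) = dot d (Q *m d).
  by rewrite dot_mulmxl Q_sym mulmxA Q_idem.
by rewrite !(dotBl, dotBr) QQ (dotC (Q *m d)); ring.
Qed.

(** The gradient terms produced by the two quadratic models at the intermediate
    point [w] are of the form eliminated by [balance_cancel]. *)
Lemma transport_le (nu : R) (f : 'cV[R]_n -> R) : 0 < nu -> C11 nu f ->
  (forall i j, i \in I -> j \in J -> 0 <= mu i j) ->
  \sum_(i in I) \sum_(j in J) mu i j * (f (x i) - f (x j)) <=
  nu / 2 * \sum_(i in I) \sum_(j in J) mu i j * dot (x i - x j) (x i - x j).
Proof.
move=> nu0 fC mu0; pose g := gradient f.
(* The cancelling gradient terms are put back into the right-hand side. *)
rewrite -[leRHS]add0r -[X in _ <= X + _](balance_cancel (g \o x) (g \o x)).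
rewrite mulr_sumr -big_split /=.
apply: ler_sum => i iI; rewrite mulr_sumr -big_split /=.
apply: ler_sum => j jJ; rewrite mulrCA -mulrDr ler_wpM2l ?mu0//.
set d := x i - x j; pose w := x j + (d - Q *m d).
have wj : w - x j = d - Q *m d by rewrite /w addrC addKr.
have wi : w - x i = - (Q *m d).
  by rewrite /w /d addrA (addrC (x j)) subrK addrAC subrr add0r.
have := descent_upper nu f (x j) w nu0 fC; rewrite wj.
have := descent_lower nu f (x i) w nu0 fC; rewrite wi !(dotNl, dotNr) opprK.
rewrite (proj_pythagoras d) mulrDr -/g.
move: (f w) (f (x i)) (f (x j)) (dot _ _) (dot _ _) (dot _ _) (dot _ _).
move=> fw fi fj a b c e; lra.
Qed.

(** With [d = x i - x j], the squared norm of [d] minus the difference of the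
    quadratic form of [1 - 2 Q] equals
    [2 * dot (x i) (Q d) - 2 * dot (x j) (d - Q d)], which [balance_cancel]
    eliminates. *)
Lemma transport_cost :
  \sum_(i in I) \sum_(j in J) mu i j * dot (x i - x j) (x i - x j) =
  \sum_(i in I) \sum_(j in J) mu i j *
    (dot (x i) ((1%:M - 2 *: Q) *m x i) - dot (x j) ((1%:M - 2 *: Q) *m x j)).
Proof.
apply/eqP; rewrite -subr_eq0; apply/eqP.
rewrite -[RHS](balance_cancel (fun i => 2 *: x i) (fun j => - (2 *: x j))).
rewrite -sumrB; apply: eq_bigr => i _; rewrite -sumrB; apply: eq_bigr => j _.
rewrite -mulrBr; congr (_ * _).
have QC (u v : 'cV[R]_n) : dot u (Q *m v) = dot v (Q *m u).
  by rewrite dotC dot_mulmxl Q_sym.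
rewrite !mulmxBl !mul1mx -!scalemxAl !mulmxBr.
rewrite !(dotNl, dotBl, dotBr, dotZl, dotZr).
by rewrite (dotC (x j) (x i)) (QC (x j) (x i)); ring.
Qed.

Section Marginals.
Variable l : T -> R.
Hypothesis row_marginal : forall i, i \in I -> \sum_(j in J) mu i j = l i.
Hypothesis col_marginal : forall j, j \in J -> \sum_(i in I) mu i j = - l j.

Lemma marginals (F : T -> R) :
  \sum_(i in I) \sum_(j in J) mu i j * (F i - F j) =
  \sum_(i in I) l i * F i + \sum_(j in J) l j * F j.
Proof.
under eq_bigr => i _ do under eq_bigr => j _ do rewrite mulrBr.
under eq_bigr => i _ do rewrite sumrB.
rewrite sumrB; congr (_ + _).
  by apply: eq_bigr => i iI; rewrite -mulr_suml row_marginal.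
rewrite exchange_big -sumrN; apply: eq_bigr => j jJ.
by rewrite -mulr_suml col_marginal // mulNr opprK.
Qed.

End Marginals.
End Transport.

(** * Completing the rows of M to a transport plan *)

Section Plan.
Context {R : realType} {n : nat} {T : finType}.
Variables (o : T) (I J : {set T}) (x : T -> 'cV[R]_n) (l : T -> R).
Variables (mu : T -> T -> R) (Q G : 'M[R]_n).
Local Notation y i := (x i - x o).
Hypothesis oJ : o \in J.
Hypothesis l_o : l o = -1.
Hypothesis sum_l : \sum_(i in I) l i + \sum_(j in J) l j = 0.
Hypothesis sum_ly :
  \sum_(i in I) l i *: y i + \sum_(j in J) l j *: y j = 0.
Hypothesis Q_idem : Q *m Q = Q.
Hypothesis Q_sym : Q^T = Q.
Hypothesis GQ : G *m Q = Q *m G.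
Hypothesis GE : forall v, G *m v =
  \sum_(i in I) (l i * dot (y i) v) *: y i +
  \sum_(j in J) (l j * dot (y j) v) *: y j.
Hypothesis Q_inj : forall s : T -> R,
  Q *m (\sum_(j in J :\ o) s j *: y j) = 0 -> forall j, j \in J :\ o -> s j = 0.
Hypothesis mu_o : forall i, i \in I ->
  mu i o = l i - \sum_(j in J :\ o) mu i j.
Hypothesis mu_Q : forall i, i \in I ->
  Q *m (\sum_(j in J :\ o) mu i j *: y j) = l i *: (Q *m y i).

Lemma subr_translate i j : x i - x j = y i - y j.
Proof. by rewrite opprB addrA subrK. Qed.

Lemma plan_row_marginal i : i \in I -> \sum_(j in J) mu i j = l i.
Proof. by move=> iI; rewrite (big_setD1 o oJ) /= mu_o // subrK. Qed.

Lemma plan_row_balance i : i \in I ->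
  Q *m (\sum_(j in J) mu i j *: (x i - x j)) = 0.
Proof.
move=> iI; under eq_bigr => j _ do rewrite subr_translate scalerBr.
rewrite sumrB -scaler_suml plan_row_marginal // (big_setD1 o oJ) /=.
by rewrite subrr scaler0 add0r mulmxBr mu_Q // -scalemxAr subrr.
Qed.

Lemma exchange_mu (c : T -> R) :
  Q *m (\sum_(j in J :\ o) (\sum_(i in I) c i * mu i j) *: y j) =
  \sum_(i in I) c i *: (l i *: (Q *m y i)).
Proof.
under eq_bigr => j _ do rewrite scaler_suml.
rewrite exchange_big mulmx_sumr /=; apply: eq_bigr => i iI.
rewrite -mu_Q // scalemxAr scaler_sumr; congr (_ *m _).
by apply: eq_bigr => j _; rewrite scalerA.
Qed.

Lemma sum_y_D1 (c : T -> R) :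
  \sum_(j in J) c j *: y j = \sum_(j in J :\ o) c j *: y j.
Proof. by rewrite (big_setD1 o oJ) /= subrr scaler0 add0r. Qed.

(** By [Q_inj] it suffices to check the identity after summation against the
    vectors [Q *m y j], where it reduces to [sum_ly]. *)
Lemma plan_col_marginal_D1 j : j \in J :\ o ->
  \sum_(i in I) mu i j = - l j.
Proof.
move=> jJ; apply/eqP; rewrite -addr_eq0; apply/eqP; move: j jJ.
apply: Q_inj; under eq_bigr => j _ do rewrite scalerDl.
rewrite big_split /= mulmxDr.
have /= := exchange_mu (fun=> 1).
under eq_bigr => j _ do under eq_bigr => i _ do rewrite mul1r.
move=> ->; under eq_bigr => i _ do rewrite scale1r scalemxAr.
by rewrite -mulmx_sumr -sum_y_D1 -mulmxDr sum_ly mulmx0.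
Qed.

Lemma plan_col_marginal j : j \in J -> \sum_(i in I) mu i j = - l j.
Proof.
move=> jJ; case: (eqVneq j o) => [->|jo]; last first.
  by apply: plan_col_marginal_D1; rewrite !inE jo.
rewrite (eq_bigr _ mu_o) sumrB exchange_big /=.
rewrite (eq_bigr _ plan_col_marginal_D1) sumrN opprK.
by move: sum_l; rewrite (big_setD1 o oJ) /= l_o => h; lra.
Qed.

(** Tested against a vector [b'] of the kernel of [Q], the left-hand sides are
    coefficients that [Q_inj] shows to vanish: summed against the [Q *m y j] they
    give [Q *m (G *m b') = G *m (Q *m b') = 0]. *)
Lemma plan_col_balance_D1 j : j \in J :\ o ->
  Q *m (\sum_(i in I) mu i j *: y i + l j *: y j) =
  \sum_(i in I) mu i j *: y i + l j *: y j.
Proof.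
move=> jJ; apply/eqP; rewrite -subr_eq0 -oppr_eq0 opprB; apply/eqP.
pose Z j := \sum_(i in I) mu i j *: y i + l j *: y j.
suff h b : dot b (Z j - Q *m Z j) = 0.
  by apply/matrixP => k z; rewrite (ord1 z) -dot_delta h mxE.
have -> : dot b (Z j - Q *m Z j) = dot (b - Q *m b) (Z j).
  by rewrite dotBl dotBr dot_mulmxl Q_sym.
set b' := b - Q *m b.
have Qb' : Q *m b' = 0 by rewrite mulmxBr mulmxA Q_idem subrr.
move: j jJ; apply: (Q_inj (fun j => dot b' (Z j))).
have ex := exchange_mu (fun i => dot b' (y i)).
have ZE k : dot b' (Z k) = \sum_(i in I) dot b' (y i) * mu i k + l k * dot b' (y k).
  rewrite [LHS]dotDr [in LHS]dotZr [in LHS]dot_sumr; congr (_ + _).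
  by apply: eq_bigr => i _; rewrite dotZr mulrC.
under eq_bigr => k _ do rewrite ZE scalerDl.
rewrite big_split /= mulmxDr ex.
rewrite -sum_y_D1.
transitivity (Q *m (G *m b')); last first.
  by rewrite mulmxA -GQ -mulmxA Qb' mulmx0.
rewrite GE mulmxDr [in RHS]mulmx_sumr; congr (_ + _); last congr (_ *m _).
  apply: eq_bigr => i _.
  by rewrite -scalemxAr scalerA (dotC b') (mulrC (dot _ _)).
by apply: eq_bigr => k _; rewrite (dotC b').
Qed.

Lemma plan_col_balance j : j \in J ->
  Q *m (\sum_(i in I) mu i j *: (x i - x j)) =
  \sum_(i in I) mu i j *: (x i - x j).
Proof.
move=> jJ; case: (eqVneq j o) => [->|jo]; last first.
  have jD : j \in J :\ o by rewrite !inE jo.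
  have -> : \sum_(i in I) mu i j *: (x i - x j) =
      \sum_(i in I) mu i j *: y i + l j *: y j.
    under eq_bigr => i _ do rewrite subr_translate scalerBr.
    by rewrite sumrB -scaler_suml plan_col_marginal // scaleNr opprK.
  exact: plan_col_balance_D1.
have -> : \sum_(i in I) mu i o *: y i =
   - \sum_(j in J :\ o) (\sum_(i in I) mu i j *: y i + l j *: y j).
  rewrite big_split /= exchange_big /= -sum_y_D1.
  have -> : \sum_(j in J) l j *: y j = - \sum_(i in I) l i *: y i.
    by apply/eqP; rewrite -addr_eq0 addrC sum_ly.
  rewrite opprB -sumrB; apply: eq_bigr => i iI.
  by rewrite mu_o // scalerBl scaler_suml.
rewrite mulmxN mulmx_sumr; congr (- _).
by apply: eq_bigr => k; exact: plan_col_balance_D1.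
Qed.

End Plan.

(** * Sign patterns of the sorted Lagrange values *)

Lemma card_ltn_ord (m k : nat) : (k <= m)%N -> #|[set i : 'I_m | (i < k)%N]| = k.
Proof.
move=> km; rewrite -sum1_card -[RHS]card_ord -sum1_card.
rewrite (big_ord_widen m (fun=> 1%N) km).
by apply: eq_bigl => i; rewrite inE.
Qed.

Lemma mem_downset (m : nat) (A : {set 'I_m}) :
  (forall i j : 'I_m, (i <= j)%N -> j \in A -> i \in A) ->
  forall k : 'I_m, (k \in A) = (k < #|A|)%N.
Proof.
move=> down k; apply/idP/idP => [kA|].
  rewrite -(card_ltn_ord m k.+1 (ltn_ord k)); apply/subset_leq_card/fintype.subsetP.
  by move=> i; rewrite inE ltnS => ik; exact: down kA.
apply: contraLR => kA; rewrite -leqNgt.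
rewrite -(card_ltn_ord m k (ltnW (ltn_ord k))); apply/subset_leq_card/fintype.subsetP.
move=> i iA; rewrite inE ltnNge; apply: contra kA => ki; exact: down iA.
Qed.

Section Signs.
Context {R : realType} {n : nat}.
Variables (x : 'I_n.+2 -> 'cV[R]_n) (ell : 'I_n.+2 -> 'cV[R]_n -> R).
Hypothesis ellP : lagrange_basis x ell.
Hypothesis ell_sorted : forall i j : 'I_n.+2, (0 < i)%N -> (i <= j)%N ->
     ell j (x ord0) <= ell i (x ord0).

Local Notation l i := (ell i (x ord0)).
Local Notation I := (Iplus x ell).
Local Notation J := (Iminus x ell).
Local Notation m := (#|J|.-1).

(** These are the indices of the points behind row [k] of [Yplus] and row [r] of
    [Yminus]. *)
Definition iplus (k : 'I_#|I|) : 'I_n.+2 := lift ord0 (inord k).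
Definition iminus (r : 'I_m) : 'I_n.+2 := lift ord0 (inord (n.+1 - m + r)).

Lemma ord0_Iminus : ord0 \in J.
Proof. by rewrite inE ellP.1 ltrN10. Qed.

Lemma ord0_Iplus : (ord0 \in I) = false.
Proof. by rewrite inE ellP.1 ltr0N1. Qed.

Lemma lift_sorted (j k : 'I_n.+1) : (j <= k)%N ->
  l (lift ord0 k) <= l (lift ord0 j).
Proof. by move=> jk; apply: ell_sorted; rewrite ?lift0. Qed.

Lemma card_Iplus : #|I| = #|[set k : 'I_n.+1 | 0 < l (lift ord0 k)]|.
Proof.
rewrite -(card_imset _ (@lift_inj n.+2 ord0)); apply: eq_card => i.
case: (unliftP ord0 i) => [k ->|->].
  by rewrite (mem_imset _ _ (@lift_inj n.+2 ord0)) !inE.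
rewrite ord0_Iplus; apply/esym/negP => /imsetP[k _ /eqP].
by rewrite (negbTE (neq_lift _ _)).
Qed.

(** The predecessor accounts for [ord0], which is an element of [Iminus]. *)
Lemma card_Iminus :
  m = #|~: [set k : 'I_n.+1 | 0 <= l (lift ord0 k)]|.
Proof.
rewrite (cardsD1 ord0 J) ord0_Iminus add1n /=.
rewrite -(card_imset _ (@lift_inj n.+2 ord0)); apply: eq_card => i.
case: (unliftP ord0 i) => [k ->|->].
  by rewrite (mem_imset _ _ (@lift_inj n.+2 ord0)) !inE ltNge.
rewrite !inE eqxx; apply/esym/negP => /imsetP[k _ /eqP].
by rewrite (negbTE (neq_lift _ _)).
Qed.

Lemma card_Iplus_le : (#|I| <= n.+1)%N.
Proof. by rewrite card_Iplus -[leqRHS]card_ord max_card. Qed.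

Lemma card_Iminus_le : (m <= n.+1)%N.
Proof. by rewrite card_Iminus -[leqRHS]card_ord max_card. Qed.

Lemma mem_Iplus (k : 'I_n.+1) : (lift ord0 k \in I) = (k < #|I|)%N.
Proof.
rewrite card_Iplus -mem_downset => [|i j ij]; first by rewrite !inE.
by rewrite !inE => jp; apply: lt_le_trans jp (lift_sorted _ _ ij).
Qed.

Lemma mem_Iminus (k : 'I_n.+1) : (lift ord0 k \in J) = (n.+1 - m <= k)%N.
Proof.
set A := [set k : 'I_n.+1 | 0 <= l (lift ord0 k)]%SET.
have -> : (n.+1 - m = #|A|)%N.
  by rewrite card_Iminus -[X in (X - _)%N](card_ord n.+1) -(cardsC A) addnK.
rewrite leqNgt -mem_downset; first by rewrite !inE ltNge.
move=> i j ij; rewrite !inE => jp; apply: le_trans jp (lift_sorted _ _ ij).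
Qed.

Lemma iplusE k : iplus k = k.+1 :> nat.
Proof. by rewrite /iplus lift0 inordK // (leq_trans (ltn_ord k)) ?card_Iplus_le. Qed.

Lemma iminusE r : iminus r = (n.+1 - m + r).+1 :> nat.
Proof.
rewrite /iminus lift0 inordK // -[X in (_ < X)%N](subnK card_Iminus_le).
by rewrite ltn_add2l.
Qed.

Lemma iminus_inj : injective iminus.
Proof.
by move=> k k' /(congr1 (@nat_of_ord _)); rewrite !iminusE => -[/addnI/val_inj].
Qed.

Lemma Iplus_imset : I = [set iplus k | k : 'I_#|I|]%SET.
Proof.
apply/setP => i; apply/idP/imsetP => [|[k _ ->]]; last first.
  by rewrite /iplus mem_Iplus inordK // (leq_trans (ltn_ord k)) ?card_Iplus_le.
case: (unliftP ord0 i) => [k ->|->]; last by rewrite ord0_Iplus.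
rewrite mem_Iplus => kp; exists (Ordinal kp) => //.
by apply: ord_inj; rewrite iplusE lift0.
Qed.

Lemma Iminus_imset : (J :\ ord0 = [set iminus r | r : 'I_m])%SET.
Proof.
apply/setP => i; apply/idP/imsetP => [|[r _ ->]]; last first.
  rewrite !inE /iminus eq_sym neq_lift.
  have := mem_Iminus (inord (n.+1 - m + r)); rewrite inE => ->.
  by have := iminusE r; rewrite /iminus lift0 => -[->]; exact: leq_addr.
case: (unliftP ord0 i) => [k ->|->]; last by rewrite !inE eqxx.
rewrite 2!inE => /andP[_]; rewrite mem_Iminus => mk.
have km : (k - (n.+1 - m) < m)%N.
  by rewrite ltn_subLR // subnK ?card_Iminus_le.
exists (Ordinal km) => //.
by apply: ord_inj; rewrite iminusE lift0 subnKC.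
Qed.

Lemma big_Iminus (V : nmodType) (F : 'I_n.+2 -> V) :
  \sum_(j in (J :\ ord0)%SET) F j = \sum_(r < m) F (iminus r).
Proof.
rewrite Iminus_imset.
by rewrite big_imset => [|? ? _ _] /=; [apply: eq_bigl => k|exact: iminus_inj].
Qed.

Lemma big_signs (V : nmodType) (F : 'I_n.+2 -> V) :
  (forall i, l i = 0 -> F i = 0) ->
  \sum_i F i = \sum_(i in I) F i + \sum_(i in J) F i.
Proof.
move=> F0; rewrite (bigID (mem I)) /=; congr (_ + _).
rewrite (bigID (mem J)) /= addrC big1 ?add0r => [|i].
  apply: eq_bigl => i; rewrite !inE -leNgt.
  by rewrite andb_idl // => /ltW.
rewrite !inE -!leNgt => /andP[l0 l1]; apply: F0.
by apply/eqP; rewrite eq_le l0 l1.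
Qed.

End Signs.

(** * The negative eigenspace of G *)

Lemma colsub_mul {R : realType} {m n p q : nat} (g : 'I_q -> 'I_p)
  (A : 'M[R]_(m, n)) (B : 'M[R]_(n, p)) :
  A *m colsub g B = colsub g (A *m B).
Proof.
by apply/matrixP => i j; rewrite !mxE; apply: eq_bigr => k _; rewrite mxE.
Qed.

Lemma row_free_tr_inj {R : realType} {p q : nat} (N : 'M[R]_(p, q)) :
  (forall v : 'cV_q, N *m v = 0 -> v = 0) -> row_free N^T.
Proof.
move=> inj; apply: inj_row_free => v vN; apply: trmx_inj; rewrite trmx0.
by apply: inj; rewrite -[N]trmxK -trmx_mul vN trmx0.
Qed.

Lemma inj_mulmx_leq {R : realType} {p q : nat} (N : 'M[R]_(p, q)) :
  (forall v : 'cV_q, N *m v = 0 -> v = 0) -> (q <= p)%N.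
Proof. by move/row_free_tr_inj => /eqP <-; exact: rank_leq_col. Qed.

Lemma inj_mulmx_unit {R : realType} {p : nat} (N : 'M[R]_p) :
  (forall v : 'cV_p, N *m v = 0 -> v = 0) -> N \in unitmx.
Proof. by move/row_free_tr_inj; rewrite row_free_unit unitmx_tr. Qed.

Lemma conform_colsub {R : realType} {n k m : nat} (E : k = m) (f : 'I_k -> 'I_n)
  (B : 'M[R]_(n, m)) (P : 'M[R]_n) :
  conform_mx B (colsub f P) = colsub (f \o cast_ord (esym E)) P.
Proof.
case: m / E B => B; rewrite conform_mx_id; apply/matrixP => i j.
by rewrite !mxE /= cast_ord_id.
Qed.

Section Spectral.
Context {R : realType} {n : nat}.
Variables (x : 'I_n.+2 -> 'cV[R]_n) (ell : 'I_n.+2 -> 'cV[R]_n -> R).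
Variables (P : 'M[R]_n) (lambda : 'rV[R]_n).
Hypothesis ellP : lagrange_basis x ell.
Hypothesis ell_sorted : forall i j : 'I_n.+2, (0 < i)%N -> (i <= j)%N ->
     ell j (x ord0) <= ell i (x ord0).
Hypothesis eigP : eigendecomposition (Gmx x ell) P lambda.

Local Notation l i := (ell i (x ord0)).
Local Notation I := (Iplus x ell).
Local Notation J := (Iminus x ell).
Local Notation m := (#|J|.-1).
Local Notation G := (Gmx x ell).
Local Notation y i := (x i - x ord0).
Local Notation neg := (negative_eigs lambda).
Local Notation im := (iminus x ell).

Lemma PtP : P^T *m P = 1%:M. Proof. exact: eigP.1. Qed.

Lemma eig_form (w : 'cV[R]_n) :
  dot w (G *m w) = \sum_j lambda 0 j * (P^T *m w) j 0 ^+ 2.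
Proof.
rewrite eigP.2 -!mulmxA -[X in dot w (X *m _)]trmxK -dot_mulmxl.
by apply: eq_bigr => j _; rewrite mul_diag_mx [X in _ * X]mxE; ring.
Qed.

(** On a vector of the negative eigenspace the form of [G] is nonpositive.  If
    the vector is also orthogonal to every [y j] of negative weight, the form
    is a sum of nonnegative terms, so that it and the vector vanish. *)
Lemma Yminus_colsub_inj (q : nat) (g : 'I_q -> 'I_n) (v : 'cV[R]_q) :
  injective g -> (forall r, g r \in neg) ->
  Yminus x ell *m colsub g P *m v = 0 -> v = 0.
Proof.
move=> g_inj g_neg; rewrite -mulmxA; set w := colsub g P *m v => Yw.
have Pw : P^T *m w = colsub g 1%:M *m v by rewrite /w mulmxA colsub_mul PtP.
have Pwg r : (P^T *m w) (g r) 0 = v r 0.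
  rewrite Pw mxE (bigD1 r) //= !mxE eqxx mul1r big1 ?addr0 // => r' r'r.
  by rewrite !mxE (inj_eq g_inj) eq_sym (negbTE r'r) mul0r.
have Pw0 j : j \notin neg -> (P^T *m w) j 0 = 0.
  move=> jn; rewrite Pw mxE big1 // => r _; rewrite !mxE.
  by case: eqP => [jr|_]; [rewrite jr g_neg in jn|rewrite mul0r].
have yw j : j \in J -> dot (y j) w = 0.
  case: (eqVneq j ord0) => [-> _|j0 jJ].
    by rewrite subrr dotC dot0r.
  have : j \in (J :\ ord0)%SET by rewrite in_setD1 j0.
  rewrite Iminus_imset // => /imsetP[r _ ->].
  have /matrixP/(_ r 0) := Yw; rewrite [RHS]mxE => <-; rewrite mxE.
  by apply: eq_bigr => k _; rewrite !mxE.
have ge0 : 0 <= dot w (G *m w).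
  rewrite (Gmx_form _ _ ellP w (- dot (x ord0) w)); apply: sumr_ge0 => i _.
  rewrite -dotBl; have [lt0|] := ltP (l i) 0.
    by rewrite yw ?inE // expr0n mulr0.
  by move=> l0; rewrite mulr_ge0 // sqr_ge0.
have tpos j : 0 <= - (lambda 0 j * (P^T *m w) j 0 ^+ 2).
  case: (boolP (j \in neg)) => jn; last by rewrite Pw0 // expr0n mulr0 oppr0.
  rewrite oppr_ge0 nmulr_rle0 ?sqr_ge0 //; by rewrite inE in jn.
have s0 : \sum_j - (lambda 0 j * (P^T *m w) j 0 ^+ 2) = 0.
  apply/eqP; rewrite eq_le sumr_ge0 ?andbT; last by move=> j _; exact: tpos.
  by rewrite sumrN oppr_le0 -eig_form.
apply/matrixP => r z; rewrite (ord1 z) [RHS]mxE -Pwg.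
have z0 := psumr_eq0P (fun j _ => tpos j) s0.
have /eqP := @z0 (g r) isT.
rewrite oppr_eq0 mulf_eq0 sqrf_eq0 => /orP[|/eqP //].
by have := g_neg r; rewrite inE => /lt_eqF ->.
Qed.

Lemma card_neg_le : (#|neg| <= m)%N.
Proof.
pose g (r : 'I_#|neg|) : 'I_n := enum_val r.
apply: (@inj_mulmx_leq _ _ _ (Yminus x ell *m colsub g P)) => v.
apply: Yminus_colsub_inj; first exact: enum_val_inj.
by move=> r; exact: enum_valP.
Qed.

(** The gradients of the Lagrange polynomials of negative weight span a space
    on which the form of [G] is negative definite: for
    [h = \sum_r s r * ell (im r)] the weighted sum of the squares of the values
    of [h] only has nonpositive terms, [h] being zero at the points of positive
    weight.  Hence this space meets the sum of the other eigenspaces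
    trivially. *)
Lemma card_neg_ge : (m <= #|neg|)%N.
Proof.
have [a [c acP]] := lagrange_coef _ _ ellP.
pose i0 (r : 'I_m) : 'I_n.+1 := inord (n.+1 - m + r).
have imE r : im r = lift ord0 (i0 r) by [].
pose g (r : 'I_#|neg|) : 'I_n := enum_val r.
pose A : 'M[R]_(n, m) := \matrix_(k, r) a (i0 r) k 0.
apply: (@inj_mulmx_leq _ _ _ ((colsub g P)^T *m A)) => s.
rewrite -mulmxA; set w := A *m s => Pw.
have Pw0 j : j \in neg -> (P^T *m w) j 0 = 0.
  move=> jn; have /matrixP/(_ (enum_rank_in jn j) 0) := Pw.
  rewrite [RHS]mxE => <-; rewrite !mxE; apply: eq_bigr => k _.
  by rewrite !mxE /g enum_rankK_in.
have ge0 : 0 <= dot w (G *m w).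
  rewrite eig_form; apply: sumr_ge0 => j _.
  case: (boolP (j \in neg)) => jn; first by rewrite Pw0 // expr0n mulr0.
  by rewrite mulr_ge0 ?sqr_ge0 //; move: jn; rewrite inE -leNgt.
pose d := \sum_r s r 0 * c (i0 r).
pose h u := \sum_r s r 0 * ell (im r) u.
have hE u : dot u w + d = h u.
  have -> : w = \sum_r s r 0 *: a (i0 r).
    apply/matrixP => k z; rewrite (ord1 z) summxE mxE.
    by apply: eq_bigr => r _; rewrite !mxE mulrC.
  rewrite dot_sumr -big_split /=; apply: eq_bigr => r _.
  by rewrite dotZr imE acP dotC mulrDr.
have hx i : i != ord0 -> h (x i) = \sum_r s r 0 * (i == im r)%:R.
  by move=> i0'; apply: eq_bigr => r _; rewrite (ellP.2 (im r) isT).2.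
have himr r : h (x (im r)) = s r 0.
  rewrite hx // (bigD1 r) //= eqxx mulr1 big1 ?addr0 // => r' r'r.
  by rewrite (inj_eq (iminus_inj x ell ellP)) eq_sym (negbTE r'r) mulr0.
have tpos i : 0 <= - (l i * h (x i) ^+ 2).
  rewrite oppr_ge0; case: (boolP (i \in J)) => [iJ|iJ].
    by rewrite nmulr_rle0 ?sqr_ge0 //; rewrite inE in iJ.
  rewrite hx; last by apply: contraNneq iJ => ->; rewrite ord0_Iminus.
  rewrite big1 ?expr0n ?mulr0 // => r _; case: eqP => [ir|_]; last exact: mulr0.
  have : im r \in (J :\ ord0)%SET by rewrite Iminus_imset // imset_f.
  by rewrite -ir in_setD1 (negbTE iJ) andbF.
have s0 : \sum_i - (l i * h (x i) ^+ 2) = 0.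
  apply/eqP; rewrite eq_le sumr_ge0 ?andbT; last by move=> j _; exact: tpos.
  rewrite sumrN oppr_le0; apply: le_trans ge0 _.
  rewrite (Gmx_form _ _ ellP w d); apply: ler_sum => i _.
  by rewrite hE.
apply/matrixP => r z; rewrite (ord1 z) [RHS]mxE -himr.
have z0 := psumr_eq0P (fun j _ => tpos j) s0.
have /eqP := @z0 (im r) isT.
rewrite oppr_eq0 mulf_eq0 sqrf_eq0 => /orP[|/eqP //].
have : im r \in (J :\ ord0)%SET by rewrite Iminus_imset // imset_f.
by rewrite !inE => /andP[_ /lt_eqF ->].
Qed.

Lemma card_neg : #|neg| = m.
Proof. by apply/eqP; rewrite eqn_leq card_neg_le card_neg_ge. Qed.

Definition negcol (r : 'I_m) : 'I_n := enum_val (cast_ord (esym card_neg) r).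

Lemma PminusE : Pminus x ell P lambda = colsub negcol P.
Proof. by rewrite /Pminus (conform_colsub card_neg). Qed.

Lemma negcol_inj : injective negcol.
Proof. by move=> r r' /enum_val_inj/cast_ord_inj. Qed.

Local Notation Pm := (Pminus x ell P lambda).

(** The dimensions match by [card_neg], so injectivity is enough. *)
Lemma YP_unit : Yminus x ell *m Pm \in unitmx.
Proof.
apply: inj_mulmx_unit => v; rewrite PminusE; apply: Yminus_colsub_inj.
  exact: negcol_inj.
by move=> r; exact: enum_valP.
Qed.

(** The orthogonal projector onto the negative eigenspace. *)
Definition negproj : 'M[R]_n := Pm *m Pm^T.
Local Notation Q := negproj.

Lemma Pm_orthonormal : Pm^T *m Pm = 1%:M.
Proof.
apply/matrixP => r r'; rewrite PminusE [LHS]mxE.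
have /matrixP/(_ (negcol r) (negcol r')) := PtP.
rewrite !mxE (inj_eq negcol_inj) => <-.
by apply: eq_bigr => k _; rewrite !mxE.
Qed.

Lemma negproj_sym : Q^T = Q.
Proof. by rewrite /negproj trmx_mul trmxK. Qed.

Lemma negproj_idem : Q *m Q = Q.
Proof. by rewrite /negproj mulmxA -(mulmxA Pm) Pm_orthonormal mulmx1. Qed.

Lemma negproj_eq0 (v : 'cV[R]_n) : Q *m v = 0 <-> Pm^T *m v = 0.
Proof.
split=> [h|h]; last by rewrite /negproj -mulmxA h mulmx0.
rewrite -[Pm^T]mul1mx -Pm_orthonormal -!mulmxA (mulmxA Pm) -/negproj.
by rewrite h mulmx0.
Qed.

Lemma negproj_diag :
  Q = P *m diag_mx (\row_j (lambda 0 j < 0)%R%:R) *m P^T.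
Proof.
apply/matrixP => a b; rewrite /negproj PminusE [LHS]mxE [RHS]mxE.
transitivity (\sum_(j in neg) P a j * P b j).
  rewrite [RHS]big_enum_val [RHS](reindex (cast_ord (esym card_neg))) /=; last first.
    by exists (cast_ord card_neg) => r _; apply: ord_inj.
  by apply: eq_bigr => r _; rewrite !mxE.
rewrite [LHS]big_mkcond; apply: eq_bigr => j _.
rewrite mul_mx_diag !mxE inE.
by case: ifP => _; rewrite ?mulr1 // mulr0 mul0r.
Qed.

Lemma mulmx_eigs (d d' : 'rV[R]_n) :
  (P *m diag_mx d *m P^T) *m (P *m diag_mx d' *m P^T) =
  P *m diag_mx (\row_j (d 0 j * d' 0 j)) *m P^T.
Proof.
rewrite -!mulmxA; congr (P *m _); rewrite !mulmxA.
rewrite -(mulmxA (diag_mx d)) PtP mulmx1; congr (_ *m _).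
by rewrite mulmx_diag.
Qed.

Lemma negproj_comm : G *m Q = Q *m G.
Proof.
rewrite negproj_diag eigP.2 !mulmx_eigs; congr (_ *m diag_mx _ *m _).
by apply/rowP => j; rewrite !mxE mulrC.
Qed.

Lemma trace_eigs (d : 'rV[R]_n) : \tr (P *m diag_mx d *m P^T) = \sum_j d 0 j.
Proof. by rewrite mxtrace_mulC mulmxA PtP mul1mx mxtrace_diag. Qed.

(** [1 - 2 Q] is the sign of [G] in the sense of the functional calculus, with
    value 1 on the kernel, and this product is the absolute value of [G]. *)
Lemma trace_sign : \tr ((1%:M - 2 *: Q) *m G) = \sum_j `|lambda 0 j|.
Proof.
rewrite mulmxBl mul1mx -scalemxAl raddfB /= mxtraceZ negproj_diag eigP.2.
rewrite mulmx_eigs !trace_eigs mulr_sumr -sumrB; apply: eq_bigr => j _.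
rewrite !mxE; case: ltP => h; first by rewrite ltr0_norm // mulr1n; ring.
by rewrite ger0_norm // mul0r mulr0 subr0.
Qed.

Lemma sign_involutive : (1%:M - 2 *: Q) *m (1%:M - 2 *: Q) = 1%:M.
Proof.
rewrite mulmxBl mul1mx mulmxBr mulmx1 -scalemxAl -scalemxAr negproj_idem.
by move: Q => Z; apply/matrixP => a b; rewrite !mxE; ring.
Qed.

Lemma sign_sym : (1%:M - 2 *: Q)^T = 1%:M - 2 *: Q.
Proof. by rewrite linearB linearZ /= trmx1 negproj_sym. Qed.

Lemma Yminus_comb (s : 'I_n.+2 -> R) :
  (\sum_(j in (J :\ ord0)%SET) s j *: y j)^T =
  (\row_r s (im r)) *m Yminus x ell.
Proof.
rewrite big_Iminus //; apply/matrixP => z k; rewrite (ord1 z) [LHS]mxE summxE mxE.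
by apply: eq_bigr => r _; rewrite !mxE.
Qed.

Lemma negproj_inj (s : 'I_n.+2 -> R) :
  Q *m (\sum_(j in (J :\ ord0)%SET) s j *: y j) = 0 ->
  forall j, j \in (J :\ ord0)%SET -> s j = 0.
Proof.
move/(negproj_eq0 _).1/(congr1 trmx); rewrite trmx_mul trmxK Yminus_comb trmx0.
rewrite -mulmxA => /(congr1 (mulmx^~ (invmx (Yminus x ell *m Pm)))).
rewrite mulmxK ?YP_unit // mul0mx => /rowP s0 j.
rewrite Iminus_imset // => /imsetP[r _ ->].
by have := s0 r; rewrite !mxE.
Qed.

(** Multiplying [Mmx] by [Yminus *m Pminus] undoes the inverse in its
    definition. *)
Lemma mu_negproj (mu : 'I_n.+2 -> 'I_n.+2 -> R) :
  (forall (i j : 'I_n.+2)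
            (k : 'I_#|I|) (r : 'I_#|J|.-1),
     k.+1 = i -> (r.+1 + n.+2 = j + #|J|)%N ->
     mu i j = Mmx x ell P lambda k r) ->
  forall i, i \in I ->
  Q *m (\sum_(j in (J :\ ord0)%SET) mu i j *: y j) = l i *: (Q *m y i).
Proof.
move=> mu_M i; rewrite {1}Iplus_imset // => /imsetP[k _ ->].
set i' := iplus x ell k.
apply/eqP; rewrite scalemxAr -subr_eq0 -mulmxBr; apply/eqP/negproj_eq0.
apply: trmx_inj; rewrite trmx_mul trmxK trmx0 linearB /= Yminus_comb.
have -> : \row_r mu i' (im r) = row k (Mmx x ell P lambda).
  apply/rowP => r; rewrite !mxE (mu_M _ _ k r) ?mxE //.
    by rewrite iplusE.
  have J0 : (0 < #|J|)%N by apply/card_gt0P; exists ord0; exact: ord0_Iminus.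
  rewrite iminusE //.
  suff ar (a b c t p : nat) :
      b = c.+1 -> (a + c)%N = p -> (t.+1 + p.+1 = (a + t).+1 + b)%N.
    apply: (ar _ _ m); first by rewrite prednK.
    exact: subnK (card_Iminus_le x ell ellP).
  by move=> -> <-; rewrite !addSn !addnS addnCA addnA.
rewrite mulmxBl -mulmxA -row_mul /Mmx mulmxKV ?YP_unit // row_mul.
rewrite linearZ /= -scalemxAl scalemxAl -mulmxBl.
rewrite (_ : _ - _ = 0) ?mul0mx //; apply/rowP => j.
rewrite !mxE (bigD1 k) //= big1 ?addr0 => [|k' k'k]; last first.
  by rewrite !mxE eq_sym (negbTE k'k) mulr0n mul0r.
rewrite !mxE eqxx mulr1n.
have -> : inord k.+1 = i' :> 'I_n.+2.
  apply: ord_inj; rewrite iplusE // inordK // ltnS.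
  by rewrite (leq_trans (ltn_ord k)) ?card_Iplus_le.
by rewrite /i' /iplus subrr.
Qed.

End Spectral.

(** * The sharp bound *)

Section SharpBound.
Context {R : realType} {n : nat}.
Variables (nu : R) (x : 'I_n.+2 -> 'cV[R]_n) (ell : 'I_n.+2 -> 'cV[R]_n -> R).
Variables (P : 'M[R]_n) (lambda : 'rV[R]_n) (mu : 'I_n.+2 -> 'I_n.+2 -> R).
Hypothesis nu_gt0 : 0 < nu.
Hypothesis ellP : lagrange_basis x ell.
Hypothesis ell_sorted : forall i j : 'I_n.+2, (0 < i)%N -> (i <= j)%N ->
     ell j (x ord0) <= ell i (x ord0).
Hypothesis eigP : eigendecomposition (Gmx x ell) P lambda.
Hypothesis mu_M : forall (i j : 'I_n.+2)
            (k : 'I_#|Iplus x ell|) (l : 'I_#|Iminus x ell|.-1),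
     k.+1 = i -> (l.+1 + n.+2 = j + #|Iminus x ell|)%N ->
     mu i j = Mmx x ell P lambda k l.
Hypothesis mu_0 : forall i, i \in Iplus x ell ->
     mu i ord0 =
       ell i (x ord0) - \sum_(j in (Iminus x ell :\ ord0)%SET) mu i j.
Hypothesis mu_ge0 : forall i j, i \in Iplus x ell -> j \in Iminus x ell ->
     0 <= mu i j.

Local Notation l i := (ell i (x ord0)).
Local Notation I := (Iplus x ell).
Local Notation J := (Iminus x ell).
Local Notation Q := (negproj x ell P lambda).

Let oJ : ord0 \in J := ord0_Iminus x ell ellP.

Let sum_l : \sum_(i in I) l i + \sum_(j in J) l j = 0.
Proof. by rewrite -(big_signs x ell R (fun i => l i)) // (sum_ell x ell ellP). Qed.

Let sum_ly : \sum_(i in I) l i *: (x i - x ord0) +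
  \sum_(j in J) l j *: (x j - x ord0) = 0.
Proof.
rewrite -(big_signs _ _ _ (fun i => l i *: (x i - x ord0))); last first.
  by move=> i ->; rewrite scale0r.
under eq_bigr => i _ do rewrite scalerBr.
rewrite sumrB -scaler_suml (sum_ell x ell ellP) (sum_ell_x x ell ellP).
by rewrite scale0r subr0.
Qed.

Let GE v : Gmx x ell *m v =
  \sum_(i in I) (l i * dot (x i - x ord0) v) *: (x i - x ord0) +
  \sum_(j in J) (l j * dot (x j - x ord0) v) *: (x j - x ord0).
Proof.
rewrite -(big_signs _ _ _ (fun i => (l i * dot (x i - x ord0) v) *: (x i - x ord0))).
  rewrite (Gmx_mulE _ _ ellP v (- x ord0) (- dot (x ord0) v)).
  by apply: eq_bigr => i _; rewrite dotBl.
by move=> i ->; rewrite mul0r scale0r.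
Qed.

Let Q_inj := negproj_inj x ell P lambda ellP ell_sorted eigP.
Let mu_Q := mu_negproj x ell P lambda ellP ell_sorted eigP mu mu_M.
Let Q_idem := negproj_idem x ell P lambda ellP ell_sorted eigP.
Let Q_sym := negproj_sym x ell P lambda.
Let GQ := negproj_comm x ell P lambda ellP ell_sorted eigP.

Lemma weighted_sum_le f : C11 nu f ->
  \sum_i l i * f (x i) <= z_lower nu lambda.
Proof.
move=> fC.
have rm := plan_row_marginal ord0 I J (fun i => l i) mu oJ mu_0.
have cm := plan_col_marginal ord0 I J x (fun i => l i) mu Q oJ (ellP.1 _) sum_l
  sum_ly Q_inj mu_0 mu_Q.
have rb := plan_row_balance ord0 I J x (fun i => l i) mu Q oJ mu_0 mu_Q.
have cb := plan_col_balance ord0 I J x (fun i => l i) mu Q (Gmx x ell) oJ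
  (ellP.1 _) sum_l sum_ly Q_idem Q_sym GQ GE Q_inj mu_0 mu_Q.
have sumE (F : 'I_n.+2 -> R) : \sum_i l i * F i =
    \sum_(i in I) \sum_(j in J) mu i j * (F i - F j).
  rewrite (marginals I J mu (fun i => l i) rm cm).
  by apply: (big_signs x ell R (fun i => l i * F i)) => i ->; rewrite mul0r.
rewrite sumE.
apply: le_trans (transport_le I J x mu Q Q_sym Q_idem rb cb nu f nu_gt0 fC mu_ge0) _.
rewrite (transport_cost I J x mu Q Q_sym rb cb).
rewrite -(sumE (fun i => dot (x i) ((1%:M - 2 *: Q) *m x i))) Gmx_trace.
by rewrite (trace_sign x ell P lambda ellP ell_sorted eigP).
Qed.

Lemma z_lower_ubound : ubound (interpolation_errors nu x) (z_lower nu lambda).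
Proof.
move=> _ [f [fhat [fC fI ->]]].
rewrite (interpolation_error x ell ellP f fhat fI) ler_norml.
rewrite weighted_sum_le // andbT lerNl -sumrN.
under eq_bigr => i _ do rewrite -mulrN.
exact: (weighted_sum_le _ (C11N nu f fC).1).
Qed.

(** The quadratic function whose Hessian is [nu] times the sign of [G]. *)
Lemma z_lower_attained : interpolation_errors nu x (z_lower nu lambda).
Proof.
set A := 1%:M - 2 *: Q.
pose f u := nu / 2 * dot u (A *m u).
have [fhat fI] := interpolant_exists x ell ellP f.
have A_sym : A^T = A := sign_sym x ell P lambda.
have AA : A *m A = 1%:M := sign_involutive x ell P lambda ellP ell_sorted eigP.
exists f, fhat; split => //.
  exact: (C11_quadratic _ _ A_sym nu (ltW nu_gt0) erefl AA).
rewrite (interpolation_error x ell ellP f fhat fI).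
rewrite (eq_bigr (fun i => nu / 2 * (l i * dot (x i) (A *m x i)))); last first.
  by move=> i _; rewrite mulrCA.
rewrite -mulr_sumr Gmx_trace (trace_sign x ell P lambda ellP ell_sorted eigP).
rewrite ger0_norm // mulr_ge0 //; first by rewrite divr_ge0 // ltW.
by apply: sumr_ge0 => j _; exact: normr_ge0.
Qed.

End SharpBound.

Theorem theorem5p1 (R : realType) (n : nat) (nu : R)
  (x : 'I_n.+2 -> 'cV[R]_n)
  (ell : 'I_n.+2 -> 'cV[R]_n -> R)
  (P : 'M[R]_n) (lambda : 'rV[R]_n)
  (mu : 'I_n.+2 -> 'I_n.+2 -> R)
  (nu_gt0 : 0 < nu)
  (Theta_indep : affinely_independent (fun k : 'I_n.+1 => x (lift ord0 k)))
  (ellP : lagrange_basis x ell)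
  (ell_sorted : forall i j : 'I_n.+2, (0 < i)%N -> (i <= j)%N ->
     ell j (x ord0) <= ell i (x ord0))
  (eigP : eigendecomposition (Gmx x ell) P lambda)
  (* entry (i, j - n - 2 + #|I_-|) of M, rows and columns numbered from 1 *)
  (mu_M : forall (i j : 'I_n.+2)
            (k : 'I_#|Iplus x ell|) (l : 'I_#|Iminus x ell|.-1),
     k.+1 = i -> (l.+1 + n.+2 = j + #|Iminus x ell|)%N ->
     mu i j = Mmx x ell P lambda k l)
  (mu_0 : forall i, i \in Iplus x ell ->
     mu i ord0 =
       ell i (x ord0) - \sum_(j in (Iminus x ell :\ ord0)%SET) mu i j)
  (mu_ge0 : forall i j, i \in Iplus x ell -> j \in Iminus x ell -> 0 <= mu i j) :
  sharp_error_bound nu x (z_lower nu lambda).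
Proof.
split.
  exact: (z_lower_attained nu x ell P lambda nu_gt0 ellP ell_sorted eigP).
exact: (z_lower_ubound nu x ell P lambda mu nu_gt0 ellP ell_sorted eigP mu_M
  mu_0 mu_ge0).
Qed.
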